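(* Let $\pi_2$ be the unitary representation of the Thompson group $F$ on the Hilbert space $\ell^2(\Omega_2)$ induced by the action of $F$ on $\Omega_2$, that is, $\pi_2(f)\delta_p=\delta_{f\cdot p}$ for $f\in F$, $p\in\Omega_2$, where $(\delta_p)_{p\in\Omega_2}$ is the canonical orthonormal basis. Then $\pi_2$ is faithful on the complex group algebra $\mathbb{C}[F]$; that is, its linear extension $\mathbb{C}[F]\to B(\ell^2(\Omega_2))$ is injective.
   Context: Let $\mathcal{O}_2$ be the Cuntz algebra, the unital $C^*$-algebra generated by two isometries $S_1,S_2$ with $S_1S_1^*+S_2S_2^*=1$. Let $W_2$ be the set of all finite words (including the empty word $\emptyset$) in the alphabet $\{1,2\}$, and let $|\mu|$ be the length of $\mu\in W_2$. For $\mu=\mu_1\cdots\mu_k\in W_2$ put $S_\mu=S_{\mu_1}\cdots S_{\mu_k}$ (with $S_\emptyset=1$) and $P_\mu=S_\mu S_\mu^*$. Let $\mathcal{D}_2$ be the $C^*$-subalgebra of $\mathcal{O}_2$ generated by the projections $P_\mu$, $\mu\in W_2$ (it is commutative). The Thompson group $F$ is realized as the group of all unitaries in $\mathcal{O}_2$ of the form $f=\sum_{(\alpha,\beta)\in\mathcal{J}}S_\alpha S_\beta^*$, where $\mathcal{J}\subseteq W_2\times W_2$ is a finite set which is the graph of a bijection between its set of first coordinates $\mathcal{J}_1$ and its set of second coordinates $\mathcal{J}_2$, with $\sum_{\alpha\in\mathcal{J}_1}P_\alpha=1=\sum_{\beta\in\mathcal{J}_2}P_\beta$, and which is order preserving: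 for $(\alpha,\beta),(\alpha',\beta')\in\mathcal{J}$, $\alpha$ precedes $\alpha'$ in the lexicographic order if and only if $\beta$ precedes $\beta'$. (This is isomorphic to the usual group of orientation-preserving piecewise linear homeomorphisms of $[0,1]$ with slopes powers of $2$ and dyadic rational breakpoints.) For $f=\sum_{(\alpha,\beta)\in\mathcal{J}}S_\alpha S_\beta^*\in F$ put $$f_0=\sum_{(\alpha,\beta)\in\mathcal{J},\ |\alpha|-|\beta|\in 2\mathbb{Z}}S_\alpha S_\beta^*,\qquad f_1=\sum_{(\alpha,\beta)\in\mathcal{J},\ |\alpha|-|\beta|\notin 2\mathbb{Z}}S_\alpha S_\beta^*$$ (these do not depend on the chosen presentation of $f$). Define $$\Omega_2=\{f_0f_0^*\mid f\in F\},$$ a set of projections in $\mathcal{D}_2$. The group $F$ acts on $\Omega_2$ by $f\cdot p=f_0pf_0^*+f_1(1-p)f_1^*$. Under the bijection $fH_2\mapsto f_0f_0^*$ this is the left translation action of $F$ on $F/H_2$, where $H_2$ is the subgroup of those $f=\sum_{(\alpha,\beta)\in\mathcal{J}}S_\alpha S_\beta^*\in F$ with $|\alpha|-|\beta|\in2\mathbb{Z}$ for all $(\alpha,\beta)\in\mathcal{J}$. *)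

(* Defs.v *)
From HB Require Import structures.
From mathcomp Require Import all_boot all_order all_algebra finmap.
From mathcomp Require Import complex.
From mathcomp Require Import all_classical all_reals all_analysis ring.

Set Implicit Arguments.
Unset Strict Implicit.
Unset Printing Implicit Defensive.

Import Order.TTheory GRing.Theory Num.Theory.
Import numFieldNormedType.Exports.
Import ComplexField.Normc.

Local Open Scope classical_set_scope.
Local Open Scope ring_scope.

(* Unital complex C*-algebras. The norm is a field of its own, with values in R:
   a structure extending both a ring and normedModType R[i] would be a missing
   join below numDomainType, which HB rejects outside the library. Nonnegativity
   of the norm, isometry of star and star 1 = 1 follow from the axioms; 1 != 0 is
   part of the algebra structure. *)
HB.mixin Record isCstarAlgebra (R : realType) A & GRing.Algebra R[i] A := {
  star : A -> A;
  starK : involutive star;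
  starD : {morph star : x y / x + y};
  starZ : forall (a : R[i]) (x : A), star (a *: x) = a^*%C *: star x;
  starM : forall x y, star (x * y) = star y * star x;
  cnorm : A -> R;
  cnorm_eq0 : forall x, cnorm x = 0 -> x = 0;
  cnormZ : forall (a : R[i]) (x : A), cnorm (a *: x) = normc a * cnorm x;
  cnormD : forall x y, cnorm (x + y) <= cnorm x + cnorm y;
  cnormM : forall x y, cnorm (x * y) <= cnorm x * cnorm y;
  cnorm_starM : forall x, cnorm (star x * x) = cnorm x ^+ 2;
  cnorm_complete : forall u : nat -> A,
    (forall e : R, 0 < e -> exists N, forall m n,
       (N <= m)%N -> (N <= n)%N -> cnorm (u m - u n) < e) ->
    exists l, cnorm (u n - l) @[n --> \oo] --> (0 : R)
}.

#[short(type="cstarAlgType")]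
HB.structure Definition CstarAlgebra (R : realType) :=
  {A of GRing.Algebra R[i] A & isCstarAlgebra R A}.

Definition cstar_subalgebra (R : realType) (A : cstarAlgType R) (B : set A) :=
  [/\ B 1, (forall (a : R[i]) x y, B x -> B y -> B (a *: x + y)),
      (forall x y, B x -> B y -> B (x * y)), (forall x, B x -> B (star x)) &
      (forall (u : nat -> A) l, (forall n, B (u n)) ->
        cnorm (u n - l) @[n --> \oo] --> (0 : R) -> B l)].

(* The Cuntz algebra O_2, which these conditions determine up to a unique
   isomorphism respecting the generators: gen ord0 is S_1, gen ord_max is S_2. *)
Record cuntzAlgType (R : realType) := CuntzAlgebra {
  cuntz_sort :> cstarAlgType R;
  gen : 'I_2 -> cuntz_sort;
  gen_isometry : forall i, star (gen i) * gen i = 1;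
  gen_sum : \sum_(i < 2) gen i * star (gen i) = 1;
  gen_generate : forall B : set cuntz_sort,
    cstar_subalgebra B -> (forall i, B (gen i)) -> B = setT
}.

Definition word := seq 'I_2.

(* Where a proper prefix is placed is irrelevant: by code_prefix_free, distinct
   words in J_1 (or J_2) of a presentation J are never prefixes of each other. *)
Definition word_lt (u v : word) : bool := ((u : seqlexi 'I_2) < v)%O.

Section words.
Variables (R : realType) (O : cuntzAlgType R).
Implicit Types u v w : word.

Definition Sword (u : word) : O := \prod_(i <- u) gen O i.
Definition Pword (u : word) : O := Sword u * star (Sword u).

(* J is the graph of an order-preserving bijection between J_1 and J_2, the sets
   of its first and second coordinates, and both sums of projections are 1. *)
Definition tree_pair (J : {fset word * word}) :=
  [/\ {in J &, injective fst}, {in J &, injective snd},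
      \sum_(u <- [fset x.1 | x in J]%fset) Pword u = 1,
      \sum_(v <- [fset x.2 | x in J]%fset) Pword v = 1 &
      {in J &, forall x y, word_lt x.1 y.1 = word_lt x.2 y.2}].

Definition even_pair (x : word * word) : bool :=
  (2 %| (size x.1)%:Z - (size x.2)%:Z)%Z.

Definition pair_sum (J : {fset word * word}) : O :=
  \sum_(x <- J) Sword x.1 * star (Sword x.2).

Definition pair_sum_even (J : {fset word * word}) : O :=
  \sum_(x <- J | even_pair x) Sword x.1 * star (Sword x.2).

Definition pair_sum_odd (J : {fset word * word}) : O :=
  \sum_(x <- J | ~~ even_pair x) Sword x.1 * star (Sword x.2).

Lemma star0 : star 0 = 0 :> O.
Proof. by apply: (addrI (star 0)); rewrite -starD !addr0. Qed.

Lemma star1 : star 1 = 1 :> O.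
Proof. by rewrite -[LHS]mul1r -{1}(starK 1) -starM mul1r starK. Qed.

Lemma starN (x : O) : star (- x) = - star x.
Proof. by apply/eqP; rewrite -addr_eq0 -starD addNr star0. Qed.

Lemma star_sum (I : Type) (r : seq I) (P : pred I) (F : I -> O) :
  star (\sum_(i <- r | P i) F i) = \sum_(i <- r | P i) star (F i).
Proof. exact: (big_morph _ (@starD R O) star0). Qed.

Definition compar u v := prefix u v || prefix v u.

Lemma comparC u v : compar u v = compar v u.
Proof. by rewrite /compar orbC. Qed.

Lemma compar_cons i j u v :
  compar (i :: u) (j :: v) = (i == j) && compar u v.
Proof. by rewrite /compar /= (eq_sym j); case: (i == j). Qed.

Lemma compar_catP u v a b : u ++ a = v ++ b -> compar u v.
Proof.
elim: u v => [|i u IH] [|j v] //=.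
by case=> <- /IH; rewrite compar_cons eqxx.
Qed.

Lemma compar_join u v : compar u v ->
  u ++ drop (size u) v = v ++ drop (size v) u.
Proof.
elim: u v => [|i u IH] [|j v] //=; rewrite ?cats0 //.
by rewrite compar_cons => /andP[/eqP<- /IH ->].
Qed.

Lemma word_lt_cat2l w u v : word_lt (w ++ u) (w ++ v) = word_lt u v.
Proof.
by elim: w => //= i w <-; rewrite /word_lt Order.SeqLexiOrder.Exports.eqhead_ltxiE.
Qed.

Lemma word_lt_catr u v a b : ~~ compar u v ->
  word_lt (u ++ a) (v ++ b) = word_lt u v.
Proof.
elim: u v => [|i u IH] [|j v] //.
rewrite compar_cons; have [<- /= /IH|ij _] := eqVneq i j.
  by rewrite /word_lt !Order.SeqLexiOrder.Exports.eqhead_ltxiE.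
by rewrite /word_lt /= !Order.SeqLexiOrder.Exports.neqhead_ltxiE.
Qed.

Lemma gen_orth (i j : 'I_2) : i != j -> star (gen O i) * gen O j = 0.
Proof.
move=> ij.
have H k : k != i -> star (gen O i) * gen O k = 0.
  move=> ki; have := congr1 ( *%R (star (gen O i))) (gen_sum O).
  rewrite mulr1 (bigD1 i) //= (bigD1 k) //= big1; last first.
    move=> l /andP[li lk]; exfalso; move: li lk ki.
    move: {ij} i l k => [[|[|i]] //= hi] [[|[|l]] //= hl] [[|[|k]] //= hk] //.
  rewrite addr0 mulrDr !mulrA gen_isometry mul1r => /eqP.
  rewrite addrC -subr_eq0 addrK => /eqP/(congr1 ( *%R^~ (gen O k))).
  by rewrite -mulrA gen_isometry mulr1 mul0r.
by apply: H; rewrite eq_sym.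
Qed.

Lemma Sword0 : Sword [::] = 1. Proof. exact: big_nil. Qed.

Lemma Sword_cons i u : Sword (i :: u) = gen O i * Sword u.
Proof. exact: big_cons. Qed.

Lemma Sword_cat u v : Sword (u ++ v) = Sword u * Sword v.
Proof. exact: big_cat. Qed.

Lemma star_SwordM u v : star (Sword u) * Sword v =
  if compar u v then Sword (drop (size u) v) * star (Sword (drop (size v) u))
  else 0.
Proof.
elim: u v => [|i u IH] [|j v].
- by rewrite !Sword0 star1.
- by rewrite /= Sword0 star1 mul1r mulr1.
- by rewrite /compar /= Sword0 mulr1 mul1r.
rewrite compar_cons !Sword_cons starM mulrA -(mulrA (star _)).
have [<-|ij] /= := eqVneq i j; last by rewrite gen_orth // mulr0 mul0r.
by rewrite gen_isometry mulr1 IH.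
Qed.

Lemma Sword_isometry u : star (Sword u) * Sword u = 1.
Proof.
by rewrite star_SwordM /compar prefix_refl drop_size Sword0 star1 mulr1.
Qed.

Lemma Sword_inj : injective Sword.
Proof.
have H i v : Sword [::] <> Sword (i :: v).
  rewrite Sword0 Sword_cons; have [j ij] : exists j : 'I_2, j != i.
    by case: i => [[|[|]]] //= ?; [exists (@Ordinal 2 1 isT)|exists ord0].
  move=> /(congr1 ( *%R (star (gen O j)))); rewrite mulr1 mulrA gen_orth //.
  rewrite mul0r => /(congr1 ( *%R^~ (gen O j))).
  by rewrite mul0r gen_isometry => /eqP; rewrite oner_eq0.
elim=> [|i u IH] [|j v] //.
- by move=> /H.
- by move=> /esym /H.
rewrite !Sword_cons; have [<-|ij] := eqVneq i j.
  move=> /(congr1 ( *%R (star (gen O i)))).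
  by rewrite !mulrA gen_isometry !mul1r => /IH ->.
move=> /(congr1 ( *%R (star (gen O i)))).
rewrite !mulrA gen_isometry gen_orth // mul1r mul0r => /(congr1 ( *%R (star (Sword u)))).
by rewrite mulr0 Sword_isometry => /eqP; rewrite oner_eq0.
Qed.

Lemma natr_inj (m n : nat) : m%:R = n%:R :> O -> m = n.
Proof.
rewrite -(scaler_nat m (1 : O)) -(scaler_nat n (1 : O)).
move=> /eqP; rewrite -subr_eq0 -scalerBl scaler_eq0 oner_eq0 orbF subr_eq0.
by rewrite eqr_nat => /eqP.
Qed.

(* Compressing the relation by S_w for a long word w counts the prefixes of w in s. *)
Lemma code_prefix_free (s : seq word) : uniq s -> \sum_(u <- s) Pword u = 1 ->
  {in s &, forall u v, compar u v -> u = v}.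
Proof.
move=> us s1.
have H u v : u \in s -> v \in s -> prefix u v -> u = v.
  move=> su sv uv; apply: contrapT => /eqP uNv.
  pose w := v ++ nseq (\max_(x <- s) size x) ord0.
  have wP x : x \in s -> star (Sword w) * Pword x * Sword w = (prefix x w)%:R.
    move=> sx; rewrite /Pword mulrA -mulrA !star_SwordM comparC.
    have xw : (size x <= size w)%N.
      rewrite size_cat size_nseq; apply: leq_trans (leq_addl _ _).
      by rewrite (big_rem x) //= leq_maxl.
    have -> : compar x w = prefix x w.
      rewrite /compar; case/boolP: (prefix w x); last by rewrite orbF.
      move=> /prefixP[t xE]; move: xw; rewrite xE size_cat -[leqRHS]addn0 leq_add2l.
      by rewrite leqn0 size_eq0 => /eqP ->; rewrite cats0 prefix_refl.
    case: ifP => [_|_]; last by rewrite mul0r.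
    have -> : drop (size w) x = [::] by rewrite drop_oversize.
    by rewrite Sword0 star1 mul1r mulr1 Sword_isometry.
  have := congr1 (fun z => star (Sword w) * z * Sword w) s1.
  rewrite mulr1 Sword_isometry mulr_sumr mulr_suml.
  rewrite (eq_big_seq (fun x => ((prefix x w : nat)%:R : O))) //.
  rewrite -natr_sum => /(@natr_inj _ 1).
  rewrite (big_rem u) //= (big_rem v) /=; last first.
    by rewrite mem_rem_uniq // !inE eq_sym uNv.
  rewrite prefix_prefix (prefix_trans uv) ?prefix_prefix //.
move=> u v su sv /orP[uv|vu]; first exact: H.
by apply/esym/H.
Qed.

Definition tree_seq (s : seq (word * word)) :=
  [/\ uniq (map fst s) /\ uniq (map snd s),
      \sum_(x <- s) Pword x.1 = 1,
      \sum_(x <- s) Pword x.2 = 1 &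
      {in s &, forall x y, word_lt x.1 y.1 = word_lt x.2 y.2}].

Lemma tree_pair_seq J : tree_pair J -> tree_seq J.
Proof.
move=> [j1 j2 s1 s2 o]; split => //.
- by rewrite !map_inj_in_uniq // fset_uniq.
- by move: s1; rewrite big_imfset.
- by move: s2; rewrite big_imfset.
Qed.

Lemma big_fset_seq (T : choiceType) (s : seq T) (P : pred T) (F : T -> O) : uniq s ->
  \sum_(x <- [fset y in s]%fset | P x) F x = \sum_(x <- s | P x) F x.
Proof.
move=> us; apply: perm_big; apply: uniq_perm => // x.
by rewrite !inE.
Qed.

Lemma inj_in_map (T1 T2 : eqType) (f : T1 -> T2) s : uniq (map f s) ->
  {in s &, injective f}.
Proof.
move=> us x y xs ys e.
have := @nth_uniq _ (f x) (map f s) (index x s) (index y s).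
rewrite size_map !index_mem => /(_ xs ys us).
rewrite !(nth_map x) ?index_mem // !nth_index // e eqxx => /esym/eqP ii.
by rewrite -(nth_index x xs) ii nth_index.
Qed.

Lemma tree_seq_pair s : tree_seq s -> tree_pair [fset x in s]%fset.
Proof.
move=> [[u1 u2] s1 s2 o].
have i1 : {in [fset x in s]%fset &, injective fst}.
  by move=> x y; rewrite !inE; apply: inj_in_map.
have i2 : {in [fset x in s]%fset &, injective snd}.
  by move=> x y; rewrite !inE; apply: inj_in_map.
have us : uniq s by exact: map_uniq u1.
split=> //.
- by rewrite big_imfset //= big_fset_seq.
- by rewrite big_imfset //= big_fset_seq.
- by move=> x y; rewrite !inE; exact: o.
Qed.

End words.

Section thompson.
Variables (R : realType) (O : cuntzAlgType R).
Implicit Types (s t : seq (word * word)) (J K : {fset word * word}).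

Local Notation pw x := (Sword O x.1 * star (Sword O x.2)).

Lemma tree_seq_code1 s : tree_seq O s ->
  {in s &, forall x y, compar x.1 y.1 -> x = y}.
Proof.
move=> [[u1 _] s1 _ _] x y xs ys /code_prefix_free xy.
apply: (inj_in_map u1) => //; apply: (xy _ O _ u1); rewrite ?big_map ?map_f //.
Qed.

Lemma tree_seq_code2 s : tree_seq O s ->
  {in s &, forall x y, compar x.2 y.2 -> x = y}.
Proof.
move=> [[_ u2] _ s2 _] x y xs ys /code_prefix_free xy.
apply: (inj_in_map u2) => //; apply: (xy _ O _ u2); rewrite ?big_map ?map_f //.
Qed.

Lemma tree_seq_uniq s : tree_seq O s -> uniq s.
Proof. by move=> [[/map_uniq]]. Qed.

Lemma tree_seq_mulS s x c : tree_seq O s -> x \in s ->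
  (\sum_(y <- s) pw y) * Sword O (x.2 ++ c) = Sword O (x.1 ++ c).
Proof.
move=> ts xs; rewrite !Sword_cat mulrA; congr (_ * _).
rewrite mulr_suml (bigD1_seq x) ?(tree_seq_uniq ts) //= big_seq_cond big1.
  by rewrite addr0 -mulrA Sword_isometry mulr1.
move=> y /andP[ys yx]; rewrite -mulrA star_SwordM ifN ?mulr0 //.
by apply: contraNN yx => /(tree_seq_code2 ts ys xs) ->.
Qed.

Lemma tree_seq_mulP s (P : pred (word * word)) : tree_seq O s ->
  (\sum_(y <- s) pw y) * (\sum_(x <- s | P x) Pword O x.2) =
  \sum_(x <- s | P x) pw x.
Proof.
move=> ts; rewrite mulr_sumr big_seq_cond [RHS]big_seq_cond.
apply: eq_bigr => x /andP[xs _]; rewrite /Pword mulrA.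
by have := tree_seq_mulS [::] ts xs; rewrite !cats0 => ->.
Qed.

Lemma even_pairE x : even_pair x = (odd (size x.1) == odd (size x.2)).
Proof.
rewrite /even_pair -eqz_mod_dvd !modz_nat eqz_nat !modn2.
by case: (odd _); case: (odd _).
Qed.

Lemma tree_seq_even_proj s t : tree_seq O s -> tree_seq O t ->
    \sum_(x <- s) pw x = \sum_(x <- t) pw x ->
  (\sum_(x <- s | even_pair x) Pword O x.2) *
  (\sum_(x <- t | even_pair x) Pword O x.2) =
  \sum_(x <- s | even_pair x) Pword O x.2.
Proof.
move=> ts tt st; case: (tt) => _ _ t2 _.
apply/eqP; rewrite -subr_eq0 -[X in _ - X]mulr1 -t2 -mulrBr.
rewrite [X in _ - X](bigID (@even_pair)) /= opprD addNKr mulrN oppr_eq0.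
rewrite mulr_suml big_seq_cond big1 // => x /andP[xs ex].
rewrite mulr_sumr big_seq_cond big1 // => y /andP[yt ey].
rewrite /Pword -mulrA (mulrA (star _)) star_SwordM.
case: ifP => [/compar_join xy|_]; last by rewrite mul0r mulr0.
have := congr1 (fun z => (\sum_(x <- s) pw x) * Sword O z) xy.
rewrite (tree_seq_mulS _ ts xs) st (tree_seq_mulS _ tt yt) => /Sword_inj e.
move: (congr1 (fun w => odd (size w)) xy) (congr1 (fun w => odd (size w)) e).
move: ex ey; rewrite !even_pairE !size_cat !oddD.
move: (odd (size x.1)) (odd (size x.2)) (odd (size y.1)) (odd (size y.2)).
by move: (odd (size (drop _ _))) (odd (size (drop _ _))) => [] [] [] [] [] [].
Qed.

Lemma star_Pword u : star (Pword O u) = Pword O u.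
Proof. by rewrite /Pword starM starK. Qed.

Lemma pair_sum_even_indep J K : tree_pair O J -> tree_pair O K ->
  pair_sum O J = pair_sum O K -> pair_sum_even O J = pair_sum_even O K.
Proof.
move=> /tree_pair_seq tJ /tree_pair_seq tK JK.
rewrite /pair_sum_even -(tree_seq_mulP _ tJ) -(tree_seq_mulP _ tK).
congr (_ * _) => //.
have starE s : star (\sum_(x <- s | even_pair x) Pword O x.2) =
    \sum_(x <- s | even_pair x) Pword O x.2.
  by rewrite star_sum; apply: eq_bigr => x _; exact: star_Pword.
rewrite -(tree_seq_even_proj tJ tK) // -[RHS]starE.
by rewrite -[in RHS](tree_seq_even_proj tK tJ) // starM !starE.
Qed.

(* The word pair of S_a S_b^* S_c S_d^*, when one of b, c is a prefix of the other. *)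
Definition pair_join (z : (word * word) * (word * word)) : word * word :=
  (z.1.1 ++ drop (size z.1.2) z.2.1, z.2.2 ++ drop (size z.2.1) z.1.2).

Definition compar_pairs s t :=
  [seq z <- [seq (x, y) | x <- s, y <- t] | compar z.1.2 z.2.1].

Lemma big_compar_pairs s t (P : pred (word * word)) (F : word * word -> O) :
  \sum_(w <- map pair_join (compar_pairs s t) | P w) F w =
  \sum_(x <- s) \sum_(y <- t)
    (if compar x.2 y.1 && P (pair_join (x, y)) then F (pair_join (x, y)) else 0).
Proof.
by rewrite big_map big_filter_cond big_mkcond big_allpairs_dep.
Qed.

Lemma pw_mul x y : pw x * pw y =
  if compar x.2 y.1 then pw (pair_join (x, y)) else 0.
Proof.
rewrite mulrA -(mulrA (Sword O x.1)) star_SwordM.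
case: ifP => _; last by rewrite mulr0 mul0r.
by rewrite /= !Sword_cat starM !mulrA.
Qed.

Lemma even_pair_join x y : compar x.2 y.1 ->
  even_pair (pair_join (x, y)) = (even_pair x == even_pair y).
Proof.
move=> /compar_join /(congr1 (odd \o size)); rewrite !even_pairE /= !size_cat !oddD.
move: (odd (size x.1)) (odd (size x.2)) (odd (size y.1)) (odd (size y.2)).
by move: (odd (size (drop _ _))) (odd (size (drop _ _))) => [] [] [] [] [] [].
Qed.

Lemma word_lt_tree s x y a b : tree_seq O s -> x \in s -> y \in s ->
  word_lt (x.1 ++ a) (y.1 ++ b) = word_lt (x.2 ++ a) (y.2 ++ b).
Proof.
move=> ts xs ys; have [<-|xy] := eqVneq x y; first by rewrite !word_lt_cat2l.
rewrite !word_lt_catr; last 2 first.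
- by apply: contraNN xy => /(tree_seq_code2 ts xs ys)/eqP.
- by apply: contraNN xy => /(tree_seq_code1 ts xs ys)/eqP.
by case: ts => _ _ _; apply.
Qed.

Lemma sum_Pword_join a b (l : seq word) : \sum_(v <- l) Pword O v = 1 ->
  \sum_(v <- l) (if compar b v then Pword O (a ++ drop (size b) v) else 0) =
  Pword O a.
Proof.
move=> l1.
have -> : Pword O a = pw (a, b) * (\sum_(v <- l) Pword O v) * star (pw (a, b)).
  rewrite l1 mulr1 /= starM starK mulrA -(mulrA (Sword O a)) Sword_isometry.
  by rewrite mulr1.
rewrite mulr_sumr mulr_suml; apply: eq_bigr => v _ /=.
rewrite /Pword [in RHS]mulrA -[RHS]mulrA.
have -> : star (Sword O v) * star (Sword O a * star (Sword O b)) =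
    star (Sword O a * star (Sword O b) * Sword O v) by rewrite [RHS]starM.
rewrite -(mulrA (Sword O a)) star_SwordM; case: ifP => _; last first.
  by rewrite mulr0 mul0r.
set d := drop _ v; set e := drop _ b.
by rewrite !starM starK mulrA -!mulrA (mulrA (star (Sword O e))) Sword_isometry mul1r
  Sword_cat starM !mulrA.
Qed.

Lemma tree_seq_join s t : tree_seq O s -> tree_seq O t ->
  tree_seq O (map pair_join (compar_pairs s t)).
Proof.
move=> ts tt; have uz : uniq (compar_pairs s t).
  apply: filter_uniq; apply: allpairs_uniq; [exact: tree_seq_uniq ts|
    exact: tree_seq_uniq tt|by move=> [? ?] [? ?] _ _ [-> ->]].
have mem z : z \in compar_pairs s t ->
    [/\ z.1 \in s, z.2 \in t & compar z.1.2 z.2.1].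
  rewrite mem_filter => /andP[zc /allpairsP[[x y] /= [xs yt zE]]].
  by split; rewrite ?zE //; rewrite zE in zc.
have join z : z \in compar_pairs s t ->
    z.1.2 ++ drop (size z.1.2) z.2.1 = z.2.1 ++ drop (size z.2.1) z.1.2.
  by move=> zz; have [_ _ zc] := mem _ zz; apply: compar_join.
case: (ts) => _ s1 _ _; case: (tt) => _ _ t2 _.
split.
- split; rewrite -map_comp map_inj_in_uniq // => z w zz ww /= e.
  + have [z1 z2 zc] := mem _ zz; have [w1 w2 wc] := mem _ ww.
    have e1 : z.1 = w.1 by apply: (tree_seq_code1 ts) => //; apply: compar_catP e.
    have e2 : z.2 = w.2; last by case: z w e1 e2 {e zz ww z1 z2 zc w1 w2 wc} => ? ? [? ?] /= -> ->.
    apply: (tree_seq_code1 tt) => //.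
    move: e; rewrite e1 => /eqP; rewrite eqseq_cat // eqxx /= => /eqP e.
    by apply: (@compar_catP _ _ (drop (size z.2.1) z.1.2) (drop (size w.2.1) w.1.2)); rewrite -!join // e1 e.
  + have [z1 z2 zc] := mem _ zz; have [w1 w2 wc] := mem _ ww.
    have e2 : z.2 = w.2 by apply: (tree_seq_code2 tt) => //; apply: compar_catP e.
    have e1 : z.1 = w.1; last by case: z w e1 e2 {e zz ww z1 z2 zc w1 w2 wc} => ? ? [? ?] /= -> ->.
    apply: (tree_seq_code2 ts) => //.
    move: e; rewrite e2 => /eqP; rewrite eqseq_cat // eqxx /= => /eqP e.
    by apply: (@compar_catP _ _ (drop (size z.1.2) z.2.1) (drop (size w.1.2) w.2.1)); rewrite !join // e2 e.
- rewrite big_compar_pairs -s1; apply: eq_bigr => x _.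
  rewrite -(@sum_Pword_join x.1 x.2 (map fst t)) ?big_map; last by case: tt.
  by apply: eq_bigr => y _; rewrite andbT.
- rewrite big_compar_pairs exchange_big -t2; apply: eq_bigr => y _.
  rewrite -(@sum_Pword_join y.2 y.1 (map snd s)) ?big_map; last by case: ts.
  by apply: eq_bigr => x _; rewrite andbT comparC.
move=> _ _ /mapP[z zz ->] /mapP[w ww ->] /=.
have [z1 z2 _] := mem _ zz; have [w1 w2 _] := mem _ ww.
by rewrite (word_lt_tree _ _ ts) // !join // (word_lt_tree _ _ tt).
Qed.

Lemma pair_sum_seq s : uniq s -> pair_sum O [fset x in s]%fset = \sum_(x <- s) pw x.
Proof. exact: big_fset_seq. Qed.

Lemma pair_sum_split J : pair_sum O J = pair_sum_even O J + pair_sum_odd O J.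
Proof. exact: bigID. Qed.

Lemma pair_sum_prod J K : tree_pair O J -> tree_pair O K -> exists L,
  [/\ tree_pair O L, pair_sum O L = pair_sum O J * pair_sum O K &
      pair_sum_even O L = pair_sum_even O J * pair_sum_even O K +
                          pair_sum_odd O J * pair_sum_odd O K].
Proof.
move=> /tree_pair_seq tJ /tree_pair_seq tK.
have tL := tree_seq_join tJ tK; have uL := tree_seq_uniq tL.
exists [fset x in map pair_join (compar_pairs J K)]%fset.
split; first exact: tree_seq_pair.
  rewrite pair_sum_seq // big_compar_pairs big_distrlr /=.
  by apply: eq_bigr => x _; apply: eq_bigr => y _; rewrite pw_mul andbT.
rewrite /pair_sum_even big_fset_seq // big_compar_pairs !big_distrlr /=.
rewrite [X in _ = X + _]big_mkcond [X in _ = _ + X]big_mkcond -big_split.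
apply: eq_bigr => x _ /=.
rewrite [X in (if _ then X else 0) + _]big_mkcond.
rewrite [X in _ + (if _ then X else 0)]big_mkcond.
transitivity (\sum_(y <- K) if even_pair x == even_pair y then pw x * pw y else 0).
  apply: eq_bigr => y _; rewrite pw_mul.
  case: ifP => [/andP[c]|].
    by rewrite even_pair_join // c => ->.
  by case: (boolP (compar _ _)) => //= c; rewrite ?even_pair_join ?if_same // => ->.
case: (even_pair x); rewrite ?addr0 ?add0r; apply: eq_bigr => y _;
by case: (even_pair y).
Qed.

(* Unitarity is automatic: see thompson_mulVr and thompson_set_star. *)
Definition thompson_set : set O :=
  [set f | exists J, tree_pair O J /\ f = pair_sum O J].

Definition thompson : Type := set_type thompson_set.
HB.instance Definition _ := Choice.on thompson.
Implicit Types f g h : thompson.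

Definition presentation f : {fset word * word} := projT1 (cid (set_valP f)).

(* f_0 and f_1; by even_partE and odd_partE the chosen presentation is immaterial. *)
Definition even_part f : O := pair_sum_even O (presentation f).
Definition odd_part f : O := pair_sum_odd O (presentation f).

Lemma presentationP f :
  tree_pair O (presentation f) /\ val f = pair_sum O (presentation f).
Proof. by rewrite /presentation; case: cid. Qed.

Lemma even_partE f J : tree_pair O J -> val f = pair_sum O J ->
  even_part f = pair_sum_even O J.
Proof.
by case: (presentationP f) => tf fE tJ; rewrite fE; exact: pair_sum_even_indep.
Qed.

Lemma even_odd f : val f = even_part f + odd_part f.
Proof. by case: (presentationP f) => _ ->; exact: pair_sum_split. Qed.

Lemma odd_partE f J : tree_pair O J -> val f = pair_sum O J ->
  odd_part f = pair_sum_odd O J.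
Proof.
move=> tJ fJ; apply: (addrI (even_part f)).
by rewrite -even_odd (even_partE tJ fJ) fJ pair_sum_split.
Qed.

Lemma tree_seq1 : tree_seq O [:: ([::], [::])].
Proof.
split => //; rewrite ?big_seq1 /Pword /= ?Sword0 ?star1 ?mulr1 //.
by move=> x y; rewrite !inE => /eqP -> /eqP ->.
Qed.

Lemma pair_sum1 : pair_sum O [fset x in [:: ([::], [::])]]%fset = 1.
Proof. by rewrite pair_sum_seq // big_seq1 /= Sword0 star1 mulr1. Qed.

Lemma thompson_set1 : thompson_set 1.
Proof.
exists [fset x in [:: ([::], [::])]]%fset; rewrite pair_sum1.
by split=> //; apply: tree_seq_pair tree_seq1.
Qed.

Lemma thompson_setM (x y : O) :
  thompson_set x -> thompson_set y -> thompson_set (x * y).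
Proof.
move=> [J [tJ ->]] [K [tK ->]].
by have [L [tL e _]] := pair_sum_prod tJ tK; exists L.
Qed.

Definition pair_swap (x : word * word) := (x.2, x.1).

Lemma tree_seq_swap s : tree_seq O s -> tree_seq O (map pair_swap s).
Proof.
move=> [[u1 u2] s1 s2 o]; split.
- by split; rewrite -map_comp.
- by rewrite big_map.
- by rewrite big_map.
by move=> _ _ /mapP[x xs ->] /mapP[y ys ->] /=; rewrite o.
Qed.

Lemma thompson_set_star (x : O) : thompson_set x -> thompson_set (star x).
Proof.
move=> [J [tJ ->]]; have tS := tree_seq_swap (tree_pair_seq tJ).
exists [fset x in map pair_swap J]%fset; split; first exact: tree_seq_pair.
rewrite pair_sum_seq ?(tree_seq_uniq tS) // big_map star_sum.
by apply: eq_bigr => y _; rewrite starM starK.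
Qed.

Lemma pair_sum_range J (P Q : pred (word * word)) : tree_pair O J ->
  (\sum_(x <- J | P x) pw x) * star (\sum_(x <- J | Q x) pw x) =
  \sum_(x <- J | P x && Q x) Pword O x.1.
Proof.
move=> /tree_pair_seq tJ; rewrite star_sum big_distrlr /=.
rewrite [RHS]big_mkcondr /= big_seq_cond [RHS]big_seq_cond.
apply: eq_bigr => x /andP[xJ _].
have E y : y \in enum_fset J -> y != x -> pw x * star (pw y) = 0.
  move=> yJ yx; rewrite starM starK -mulrA (mulrA (star _)) star_SwordM.
  rewrite ifN ?mul0r ?mulr0 //.
  by apply: contraNN yx => /(tree_seq_code2 tJ xJ yJ) ->.
rewrite big_mkcond (bigD1_seq x) ?(tree_seq_uniq tJ) //= big_seq_cond big1.
  case: ifP => _; rewrite addr0 // starM starK -mulrA (mulrA (star _)).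
  by rewrite Sword_isometry mul1r.
by move=> y /andP[yJ yx]; case: ifP => // _; exact: E.
Qed.

Lemma thompson_mulVr (x : O) : thompson_set x -> x * star x = 1.
Proof.
move=> [J [tJ ->]]; rewrite pair_sum_range //.
by case: (tree_pair_seq tJ).
Qed.

Definition thompson_one : thompson := exist _ 1 (mem_set thompson_set1).
Definition thompson_mul f g : thompson :=
  exist _ (val f * val g) (mem_set (thompson_setM (set_valP f) (set_valP g))).
Definition thompson_inv f : thompson :=
  exist _ (star (val f)) (mem_set (thompson_set_star (set_valP f))).

Let thompson_mulA : associative thompson_mul.
Proof. by move=> f g h; apply: val_inj; exact: mulrA. Qed.
Let thompson_mul1g : left_id thompson_one thompson_mul.
Proof. by move=> f; apply: val_inj; exact: mul1r. Qed.
Let thompson_mulg1 : right_id thompson_one thompson_mul.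
Proof. by move=> f; apply: val_inj; exact: mulr1. Qed.
Let thompson_mulVg : left_inverse thompson_one thompson_inv thompson_mul.
Proof.
move=> f; apply: val_inj => /=.
by have := thompson_mulVr (thompson_set_star (set_valP f)); rewrite starK.
Qed.
Let thompson_mulgV : right_inverse thompson_one thompson_inv thompson_mul.
Proof. by move=> f; apply: val_inj; apply/thompson_mulVr/set_valP. Qed.

HB.instance Definition _ := isGroup.Build thompson thompson_mulA thompson_mul1g
  thompson_mulg1 thompson_mulVg thompson_mulgV.

Definition Omega_set : set O :=
  [set even_part f * star (even_part f) | f in [set: thompson]].

Definition Omega_act f (p : O) : O :=
  even_part f * p * star (even_part f) +
  odd_part f * (1 - p) * star (odd_part f).

Lemma even_partM f g : even_part (f * g)%g =
  even_part f * even_part g + odd_part f * odd_part g.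
Proof.
have [tf fE] := presentationP f; have [tg gE] := presentationP g.
have [L [tL sL eL]] := pair_sum_prod tf tg.
by rewrite (@even_partE _ L tL) // sL -fE -gE.
Qed.

Lemma Omega_actE f g :
  Omega_act f (even_part g * star (even_part g)) =
  even_part (f * g)%g * star (even_part (f * g)%g).
Proof.
have [tg gE] := presentationP g.
have c : 1 - even_part g * star (even_part g) = odd_part g * star (odd_part g).
  apply/eqP; rewrite subr_eq addrC -(thompson_mulVr (set_valP g)) gE.
  rewrite !pair_sum_range // (bigID (@even_pair)) /=.
  by apply/eqP; congr (_ + _); apply: eq_bigl => x; rewrite andbb.
have eo : even_part g * star (odd_part g) = 0.
  by rewrite pair_sum_range // big_pred0 // => x; case: even_pair.
have oe : odd_part g * star (even_part g) = 0.
  by rewrite pair_sum_range // big_pred0 // => x; case: even_pair.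
rewrite /Omega_act c even_partM starD !starM mulrDl !mulrDr !mulrA.
rewrite -(mulrA (even_part f) (even_part g) (star (odd_part g))) eo mulr0 mul0r addr0.
by rewrite -(mulrA (odd_part f) (odd_part g) (star (even_part g))) oe mulr0 mul0r add0r.
Qed.

Definition Omega : Type := set_type Omega_set.
HB.instance Definition _ := Choice.on Omega.

Lemma Omega_act_subproof f (p : Omega) : Omega_set (Omega_act f (val p)).
Proof. by case: (set_valP p) => g _ <-; rewrite Omega_actE; exists (f * g)%g. Qed.

Definition act f (p : Omega) : Omega :=
  exist _ (Omega_act f (val p)) (mem_set (Omega_act_subproof f p)).

Lemma act1 p : act 1%g p = p.
Proof.
apply: val_inj => /=; case: (set_valP p) => g _ <-.
by rewrite Omega_actE mul1g.
Qed.

Lemma actM f g p : act (f * g)%g p = act f (act g p).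
Proof.
apply: val_inj => /=; case: (set_valP p) => h _ <-.
by rewrite !Omega_actE mulgA.
Qed.

End thompson.

Section l2.
Variables (R : realType) (T : choiceType).

Definition l2_sqnorm (x : T -> R[i]) : \bar R :=
  (\esum_(t in [set: T]) (normc (x t) ^+ 2)%:E)%E.

Definition square_summable : {pred T -> R[i]^o} :=
  fun x => (l2_sqnorm x < +oo)%E.

Lemma normc_ge0 (z : R[i]) : 0 <= normc z.
Proof. by case: z => a b; exact: sqrtr_ge0. Qed.

Lemma l2_sqnorm_ge0 x : (0 <= l2_sqnorm x)%E.
Proof. by apply: esum_ge0 => t _; rewrite lee_fin sqr_ge0. Qed.

Lemma le_esumZ (c : R) (a : T -> \bar R) : 0 <= c -> (forall t, 0 <= a t)%E ->
  (\esum_(t in [set: T]) (c%:E * a t) <= c%:E * \esum_(t in [set: T]) a t)%E.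
Proof.
move=> c0 a0; apply: ge_ereal_sup => _ [F FT <-].
rewrite -ge0_mule_fsumr //; apply: lee_wpmul2l; first by rewrite lee_fin.
by apply: ereal_sup_ubound; exists F.
Qed.

Lemma l2_sqnormD (a : R[i]) (x y : T -> R[i]^o) :
  (l2_sqnorm (a *: x + y)%R <=
   (2 * normc a ^+ 2)%R%:E * l2_sqnorm x + 2%:E * l2_sqnorm y)%E.
Proof.
have a0 : 0 <= 2 * normc a ^+ 2 by rewrite mulr_ge0 // sqr_ge0.
have H (z : T -> R[i]) t : (0 <= (normc (z t) ^+ 2)%:E)%E by rewrite lee_fin sqr_ge0.
apply: le_trans; last first.
  by apply: leeD; apply: le_esumZ => //; exact: H.
rewrite -esumD; last 2 first.
- by move=> t _; rewrite mule_ge0 // lee_fin.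
- by move=> t _; rewrite mule_ge0 // lee_fin.
apply: le_esum => t _; rewrite -!EFinM -EFinD lee_fin.
have := le_normcD (a * x t) (y t); rewrite normcM.
have -> : (a *: x + y) t = a * x t + y t by [].
move: (normc_ge0 (a * x t + y t)) (normc_ge0 a) (normc_ge0 (x t)) (normc_ge0 (y t)).
move: (normc _) (normc a) (normc (x t)) (normc (y t)) => n na nx ny n0 na0 nx0 ny0 le_n.
apply: (@le_trans _ _ ((na * nx + ny) ^+ 2)).
  by rewrite ler_sqr ?nnegrE // addr_ge0 // mulr_ge0.
rewrite -subr_ge0.
have -> : 2 * na ^+ 2 * nx ^+ 2 + 2 * ny ^+ 2 - (na * nx + ny) ^+ 2 =
  (na * nx - ny) ^+ 2 by ring.
exact: sqr_ge0.
Qed.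

Lemma square_summable_submod : submod_closed square_summable.
Proof.
split=> [|a x y].
  rewrite /square_summable /in_mem /= /l2_sqnorm esum1 ?ltry // => t _.
  by rewrite normc0 expr0n.
rewrite /square_summable /in_mem /= => xl yl.
apply: le_lt_trans (l2_sqnormD a x y) _.
by rewrite lte_add_pinfty // lte_mul_pinfty // lee_fin mulr_ge0 // sqr_ge0.
Qed.

HB.instance Definition _ := GRing.isSubSemiModClosed.Build _ _ square_summable
  (GRing.submod_closed_semi square_summable_submod).

Record l2 : Type := L2 {
  l2_fun :> T -> R[i]^o;
  l2_summable : l2_fun \in square_summable
}.

HB.instance Definition _ := [isSub for l2_fun].
HB.instance Definition _ := [Choice of l2 by <:].
HB.instance Definition _ := [SubChoice_isSubLmodule of l2 by <:].

Definition l2_norm (x : l2) : R := Num.sqrt (fine (l2_sqnorm x)).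

(* B(l2) is the type bounded_op of elements of this predicate. *)
Definition bounded_linear : {pred l2 -> l2} := fun A =>
  `[< (forall (a : R[i]) x y, A (a *: x + y) = a *: A x + A y) /\
      (exists M : R, forall x, l2_norm (A x) <= M * l2_norm x) >].

Lemma l2_sqnormE (x : l2) : l2_sqnorm x = (l2_norm x ^+ 2)%:E.
Proof.
rewrite /l2_norm sqr_sqrtr ?fine_ge0 ?l2_sqnorm_ge0 // fineK //.
by rewrite ge0_fin_numE ?l2_sqnorm_ge0 //; exact: l2_summable.
Qed.

Lemma bounded_linear_submod : submod_closed bounded_linear.
Proof.
split=> [|a A B].
  apply/asboolP; split=> [b x y|]; first by rewrite /= scaler0 addr0.
  exists 0 => x; rewrite mul0r /l2_norm /l2_sqnorm esum1 ?sqrtr0 // => t _.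
  by rewrite normc0 expr0n.
move=> /asboolP[Alin [M AM]] /asboolP[Blin [N BN]]; apply/asboolP; split.
  move=> b x y; have E z : (a *: A + B) z = a *: A z + B z by [].
  rewrite !E Alin Blin !scalerDr !scalerA (mulrC a b) !addrA.
  by congr (_ + _); rewrite addrAC.
exists (Num.sqrt (2 * normc a ^+ 2 * M ^+ 2 + 2 * N ^+ 2)) => x.
have n0 z : 0 <= l2_norm z by exact: sqrtr_ge0.
have sq z K : l2_norm z <= K * l2_norm x -> l2_norm z ^+ 2 <= K ^+ 2 * l2_norm x ^+ 2.
  move=> zK; rewrite -exprMn ler_sqr ?nnegrE //; exact: le_trans zK.
rewrite -ler_sqr ?nnegrE ?mulr_ge0 ?sqrtr_ge0 //.
rewrite exprMn (@sqr_sqrtr _ (_ + _)); last first.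
  by apply: addr_ge0; do ?[exact: sqr_ge0|exact: ler0n|apply: mulr_ge0].
have := l2_sqnormD a (A x) (B x).
have -> : (a *: (A x : T -> R[i]^o) + (B x : T -> R[i]^o)) = ((a *: A + B) x : l2) by [].
rewrite !l2_sqnormE -!EFinM -EFinD lee_fin => /le_trans; apply.
have c0 : 0 <= 2 * normc a ^+ 2 by rewrite mulr_ge0 // sqr_ge0.
rewrite [leRHS]mulrDl -(mulrA 2 (N ^+ 2)) -(mulrA _ (M ^+ 2)).
by apply: lerD; rewrite ler_wpM2l // sq.
Qed.

HB.instance Definition _ := GRing.isSubSemiModClosed.Build _ _ bounded_linear
  (GRing.submod_closed_semi bounded_linear_submod).

Record bounded_op : Type := BoundedOp {
  bounded_op_fun :> l2 -> l2;
  bounded_opP : bounded_op_fun \in bounded_linear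
}.

HB.instance Definition _ := [isSub for bounded_op_fun].
HB.instance Definition _ := [Choice of bounded_op by <:].
HB.instance Definition _ := [SubChoice_isSubLmodule of bounded_op by <:].

Lemma l2_delta_subproof (p : T) :
  (fun q => (q == p)%:R : R[i]^o) \in square_summable.
Proof.
rewrite /square_summable /in_mem /= /l2_sqnorm.
rewrite (eq_esum (b := fun q => if q \in [set p] then 1%E else 0%E)).
  by rewrite -esum_mkcond esum_set1 // ltry.
move=> q _; have -> : (q \in [set p]) = (q == p) by apply/idP/eqP; rewrite inE.
case: eqP => _.
  by rewrite normc1 expr1n.
by rewrite normc0 expr0n.
Qed.

Definition l2_delta (p : T) : l2 := L2 (l2_delta_subproof p).

End l2.

Section pi2.
Variables (R : realType) (O : cuntzAlgType R).
Local Notation F := (thompson O).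
Implicit Types f g : F.

Lemma act_bij f : set_bij [set: Omega O] [set: Omega O] (act f).
Proof.
split=> //.
- move=> p q _ _ /(congr1 (act (f^-1)%g)).
  by rewrite -!actM mulVg !act1.
- by move=> p _; exists (act (f^-1)%g p) => //; rewrite -actM mulgV act1.
Qed.

Lemma l2_sqnorm_act f (x : Omega O -> R[i]) :
  l2_sqnorm (fun p => x (act f p)) = l2_sqnorm x.
Proof. by rewrite /l2_sqnorm [RHS](reindex_esum _ _ _ _ (act_bij f)). Qed.

Lemma pi2_fun_subproof f (x : l2 R (Omega O)) :
  (fun p => x (act (f^-1)%g p)) \in @square_summable R (Omega O).
Proof.
by rewrite /square_summable /in_mem /= l2_sqnorm_act; exact: l2_summable.
Qed.

(* The unitary with delta_p |-> delta_(f . p), see pi2_delta. *)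
Definition pi2_fun f (x : l2 R (Omega O)) : l2 R (Omega O) :=
  L2 (pi2_fun_subproof f x).

Lemma pi2_fun_norm f x : l2_norm (pi2_fun f x) = l2_norm x.
Proof. by rewrite /l2_norm /= l2_sqnorm_act. Qed.

Lemma pi2_subproof f : pi2_fun f \in @bounded_linear R (Omega O).
Proof.
apply/asboolP; split=> [a x y|]; first exact: val_inj.
by exists 1 => x; rewrite pi2_fun_norm mul1r.
Qed.

Definition pi2 f : bounded_op R (Omega O) := BoundedOp (pi2_subproof f).

Lemma pi2_delta f p : pi2 f (l2_delta R p) = l2_delta R (act f p).
Proof.
apply/val_inj/funext => q /=; congr ((_ : bool)%:R).
apply/eqP/eqP => [<-|->]; first by rewrite -actM mulgV act1.
by rewrite -actM mulVg act1.
Qed.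

Lemma pi2_isometry f x : l2_norm (pi2 f x) = l2_norm x.
Proof. exact: pi2_fun_norm. Qed.

Lemma pi2_1 x : pi2 1%g x = x.
Proof. by apply/val_inj/funext => p /=; rewrite invg1 act1. Qed.

Lemma pi2M f g x : pi2 (f * g)%g x = pi2 f (pi2 g x).
Proof. by apply/val_inj/funext => p /=; rewrite invgM actM. Qed.

(* The underlying set of C[F]: finitely supported functions on F. *)
Definition group_algebra := {fsfun F -> R[i] with 0}.

Definition pi2_ext (a : group_algebra) : bounded_op R (Omega O) :=
  \sum_(f <- finsupp a) a f *: pi2 f.

End pi2.

(* Main.v *)
Require Import Defs.
From mathcomp Require Import all_boot all_order all_algebra finmap complex.
From mathcomp Require Import all_classical all_reals.

(** Evaluating pi_2(a) on delta_p at f.p gives the coefficient a_f as soon as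
    f.p <> g.p for the other g in the support of a, so it suffices to find, for
    finitely many g <> 1 in F, a point p of Omega_2 moved by all of them. View p
    as a 0/1-valued function on infinite words. If g maps the cylinder u to the
    cylinder v by replacing the prefix u by v, and p is constant on both, then
    g.p = p forces the two values to differ by the parity of |v| - |u|. A given
    g <> 1 so maps some cylinder u to a disjoint one; applying to p an element of
    F supported in u and having an odd slope there, p can be changed on u alone
    so as to violate this condition. Choosing u disjoint from the finitely many
    cylinders used for the previous g, one concludes by induction. *)

Set Implicit Arguments.
Unset Strict Implicit.
Unset Printing Implicit Defensive.

Import Order.TTheory GRing.Theory Num.Theory.

Local Open Scope ring_scope.

(** * Comparability of words and disjoint cylinders *)

Lemma compar_cat2l (w u v : word) : compar (w ++ u) (w ++ v) = compar u v.
Proof. by elim: w => //= i w IH; rewrite compar_cons eqxx. Qed.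

Lemma compar_cat (u v a b : word) : compar (u ++ a) (v ++ b) -> compar u v.
Proof. by move=> /compar_join; rewrite -!catA; exact: compar_catP. Qed.

Lemma incompar_cat (u v a b : word) :
  ~~ compar u v -> ~~ compar (u ++ a) (v ++ b).
Proof. exact/contraNN/compar_cat. Qed.

(** Comparable words extend to a common word, after which different letters are appended. *)
Lemma exists_incompar_cat (u v : word) : exists a b, ~~ compar (u ++ a) (v ++ b).
Proof.
have [uv|] := boolP (compar u v); last by exists [::], [::]; rewrite !cats0.
exists (drop (size u) v ++ [:: ord0]), (drop (size v) u ++ [:: ord_max]).
by rewrite !catA (compar_join uv) compar_cat2l.
Qed.

Lemma exists_neq_letter (i : 'I_2) : exists j : 'I_2, j != i.
Proof.
by case: i => [[|[|]]] // ?; [exists ord_max|exists ord0].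
Qed.

Lemma incompar_shift (d : word) : d != [::] -> exists c, ~~ compar c (d ++ c).
Proof.
case: d => // i d _; have [j ji] := exists_neq_letter i.
by exists [:: j]; rewrite compar_cons (negbTE ji).
Qed.

(** The suffix has to be the same for both words, because an element of F carries the cylinder of
    [x.2 ++ c] to that of [x.1 ++ c]. *)
Lemma exists_incompar_catr (u v : word) : u != v ->
  exists c, ~~ compar (u ++ c) (v ++ c).
Proof.
move=> uv; have [uv0|?] := boolP (compar u v); last by exists [::]; rewrite !cats0.
move: uv0 => /orP[] /prefixP[d dE]; subst.
- have [|c cP] := @incompar_shift d.
    by apply: contraNN uv => /eqP ->; rewrite cats0.
  by exists c; rewrite -catA compar_cat2l.
- have [|c cP] := @incompar_shift d.
    by apply: contraNN uv => /eqP ->; rewrite cats0.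
  by exists c; rewrite -catA compar_cat2l comparC.
Qed.

Section faithful.
Variables (R : realType) (O : cuntzAlgType R).
Implicit Types (s : seq (word * word)) (u v w : word) (f g : thompson O).
Implicit Types (p : Omega O).

Local Notation S := (Sword O).
Local Notation pw x := (Sword O x.1 * star (Sword O x.2)).

(** * Values of points of Omega_2 on cylinders *)

Lemma Sword_neq0 u : S u != 0.
Proof.
apply/eqP => u0; have := Sword_isometry O u.
by rewrite u0 mulr0 => /esym/eqP; rewrite oner_eq0.
Qed.

Lemma star_Sword_incompar u v : ~~ compar u v -> star (S u) * S v = 0.
Proof. by move=> uv; rewrite star_SwordM ifN. Qed.

(** The second coordinates are pairwise incomparable, so every summand other than that of [x] kills
    the vector. *)
Lemma tree_seq_sumS s (P : pred (word * word)) x c : tree_seq O s -> x \in s ->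
  (\sum_(y <- s | P y) pw y) * S (x.2 ++ c) = S (x.1 ++ c) *+ P x.
Proof.
move=> ts xs; rewrite big_mkcond mulr_suml.
rewrite (bigD1_seq x) ?(tree_seq_uniq ts) //= big_seq_cond big1.
  rewrite addr0; case: (P x); last by rewrite mul0r.
  by rewrite !Sword_cat -mulrA (mulrA (star _)) Sword_isometry mul1r.
move=> y /andP[ys yx]; case: (P y); last by rewrite mul0r.
rewrite -mulrA Sword_cat (mulrA (star _)) star_Sword_incompar ?mul0r ?mulr0 //.
by apply: contraNN yx => /(tree_seq_code2 ts ys xs) ->.
Qed.

Lemma tree_seq_star_sumS s (P : pred (word * word)) x c :
  tree_seq O s -> x \in s ->
  star (\sum_(y <- s | P y) pw y) * S (x.1 ++ c) = S (x.2 ++ c) *+ P x.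
Proof.
case: x => a b ts xs; have xs' : (b, a) \in map pair_swap s.
  exact: (map_f pair_swap xs).
have := tree_seq_sumS (P \o pair_swap) c (tree_seq_swap ts) xs'.
rewrite big_map /= => <-; congr (_ * _).
rewrite star_sum; apply: eq_big => y /=; first by case: y.
by rewrite starM starK.
Qed.

(* q is viewed as a 0/1-valued function, equal to b on the cylinder of u. *)
Definition cylinder_value (q : O) u (b : bool) := q * S u = S u *+ b.

Lemma cylinder_value_cat q u b c :
  cylinder_value q u b -> cylinder_value q (u ++ c) b.
Proof. by rewrite /cylinder_value Sword_cat mulrA => ->; rewrite mulrnAl. Qed.

Lemma cylinder_value_inj q u b b' :
  cylinder_value q u b -> cylinder_value q u b' -> b = b'.
Proof.
rewrite /cylinder_value => -> /eqP; have := Sword_neq0 u.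
by case: b b' => [] [] //; rewrite ?(eq_sym 0) => /negbTE ->.
Qed.

(** A point is the sum of the projections of the first coordinates of the even pairs of some g. All
    first coordinates together give 1, so one of them is comparable with [u], and the point is
    constant below both. *)
Lemma Omega_cylinder_value p u :
  exists c b, cylinder_value (val p) (u ++ c) b.
Proof.
case: (set_valP p) => g _ <-; have [/tree_pair_seq tg _] := presentationP g.
have [x xg xu] : exists2 x, x \in enum_fset (presentation g) & compar u x.1.
  apply: contrapT => nx; have := Sword_neq0 u.
  case: (tg) => _ g1 _ _; rewrite -[S u]mul1r -g1 mulr_suml big_seq big1 ?eqxx //.
  move=> x xg; rewrite /Pword -mulrA star_Sword_incompar ?mulr0 //.
  by rewrite comparC; apply/negP => ux; apply: nx; exists x.
exists (drop (size u) x.1), (even_pair x).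
rewrite compar_join // /cylinder_value -mulrA.
rewrite tree_seq_star_sumS // mulrnAr tree_seq_sumS //.
by case: (even_pair x).
Qed.

(** Only one term of the action survives below [x.1]: an even pair transports [q], an odd pair
    transports [1 - q]. *)
Lemma Omega_act_cylinder_value g q x c b : x \in presentation g ->
  cylinder_value q (x.2 ++ c) b ->
  cylinder_value (Omega_act g q) (x.1 ++ c) (b (+) ~~ even_pair x).
Proof.
move=> xg qb; have [/tree_pair_seq tg _] := presentationP g.
rewrite /cylinder_value /Omega_act mulrDl -!mulrA.
rewrite !tree_seq_star_sumS // !mulrnAr mulrBl mul1r qb mulrBr !mulrnAr.
rewrite !tree_seq_sumS //.
by case: b {qb} (even_pair x) => [] []; rewrite ?subrr ?subr0 ?addr0 ?add0r.
Qed.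

(* On v the value of g.q is b (+) ~~ even_pair x, see Omega_act_cylinder_value. *)
Definition moves_at g (q : O) u v := exists x c b,
  [/\ x \in presentation g, u = x.2 ++ c, v = x.1 ++ c,
      cylinder_value q u b & cylinder_value q v (b (+) even_pair x)].

Lemma moves_at_cat g q u v d : moves_at g q u v -> moves_at g q (u ++ d) (v ++ d).
Proof.
move=> [x [c [b [xg -> -> qu qv]]]]; exists x, (c ++ d), b.
by split; rewrite ?catA //; exact: cylinder_value_cat.
Qed.

Lemma moves_at_act g p u v : moves_at g (val p) u v -> act g p <> p.
Proof.
move=> [x [c [b [xg -> -> pu pv]]]] /(congr1 val) /= gp.
have := Omega_act_cylinder_value xg pu; rewrite gp => /(cylinder_value_inj pv).
by case: b {pu pv} (even_pair x) => [] [].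
Qed.

(** Witnesses survive a common extension of [u] and [v], and incomparability survives any extension.
    So [w] can be lengthened for one element at a time. *)
Lemma moves_at_avoid (gs : seq (thompson O)) p w :
  (forall g, g \in gs -> exists u v, moves_at g (val p) u v) ->
  exists d, forall g, g \in gs -> exists u v,
    [/\ moves_at g (val p) u v, ~~ compar u (w ++ d) & ~~ compar v (w ++ d)].
Proof.
elim: gs => [|g gs IH] H; first by exists [::].
have [g' g'gs|d dP] := IH; first by apply: H; rewrite inE g'gs orbT.
have [u [v uv]] := H g (mem_head _ _).
have [a [b ab]] := exists_incompar_cat u (w ++ d).
have [a' [b' ab']] := exists_incompar_cat (v ++ a) ((w ++ d) ++ b).
exists (d ++ b ++ b') => g'; rewrite inE => /predU1P[->|/dP].
  exists ((u ++ a) ++ a'), ((v ++ a) ++ a'); rewrite !catA; split => //.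
    by do 2 apply: moves_at_cat.
  exact: incompar_cat.
move=> [u' [v' [uv' u'd v'd]]]; exists u', v'; rewrite catA.
by split; rewrite // -[X in compar X _]cats0 incompar_cat.
Qed.

(** * Elements of F supported in a cylinder *)

(** A copy of the element [s] on the half [i], extended by the identity on the half [j]. *)
Definition graft (i j : 'I_2) s :=
  ([:: j], [:: j]) :: [seq (i :: x.1, i :: x.2) | x <- s].

Lemma Pword_cons i u : Pword O (i :: u) = gen O i * Pword O u * star (gen O i).
Proof. by rewrite /Pword Sword_cons starM !mulrA. Qed.

Lemma Pword_nil : Pword O [::] = 1.
Proof. by rewrite /Pword Sword0 star1 mulr1. Qed.

Lemma gen_sum2 i j : i != j ->
  gen O j * star (gen O j) + gen O i * star (gen O i) = 1.
Proof.
move=> ij; rewrite -(gen_sum O) (bigD1 j) //= (bigD1 i) //= big1 ?addr0 //.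
move=> k; case: i j k ij => [[|[|?]] ?] [[|[|?]] ?] [[|[|?]] ?] //.
Qed.

Lemma sum_Pword_cons i j (l : seq word) : i != j -> \sum_(u <- l) Pword O u = 1 ->
  Pword O [:: j] + \sum_(u <- l) Pword O (i :: u) = 1.
Proof.
move=> ij l1; rewrite Pword_cons Pword_nil mulr1 -(gen_sum2 ij); congr (_ + _).
under eq_bigr do rewrite Pword_cons.
by rewrite -mulr_suml -mulr_sumr l1 mulr1.
Qed.

Lemma tree_seq_graft i j s : i != j -> tree_seq O s -> tree_seq O (graft i j s).
Proof.
move=> ij [[u1 u2] s1 s2 o].
have lt k l u v : k != l -> word_lt (k :: u) (l :: v) = word_lt [:: k] [:: l].
  by move=> kl; apply: (@word_lt_catr [:: k] [:: l]);
    rewrite compar_cons (negbTE kl).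
have consj (l : seq word) : uniq l -> uniq ([:: j] :: map (cons i) l).
  move=> ul; rewrite /= map_inj_uniq // ?ul ?andbT => [|? ? [] //].
  by apply/negP => /mapP[x _ [ji]]; rewrite ji eqxx in ij.
split.
- have := consj _ u1; have := consj _ u2.
  by rewrite /= -!map_comp => ? ?; split.
- by rewrite big_cons big_map -(big_map fst xpredT (fun u => Pword O (i :: u)))
    sum_Pword_cons // big_map.
- by rewrite big_cons big_map -(big_map snd xpredT (fun u => Pword O (i :: u)))
    sum_Pword_cons // big_map.
- move=> x y; rewrite !inE => /predU1P[->|/mapP[x' xs ->]];
  move=> /predU1P[->|/mapP[y' ys ->]] //=.
  + by rewrite !(lt j i) // eq_sym.
  + by rewrite !(lt i j).
  + by rewrite !(word_lt_cat2l [:: i]) o.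
Qed.

(* A standard generator of F; its slope is odd on the first cylinder. *)
Definition x0_pairs : seq (word * word) :=
  [:: ([:: ord0; ord0], [:: ord0]); ([:: ord0; ord_max], [:: ord_max; ord0]);
      ([:: ord_max], [:: ord_max; ord_max])].

Lemma tree_seq_x0_pairs : tree_seq O x0_pairs.
Proof.
have H : \sum_(u <- [:: [:: ord_max]; [:: ord0] : word]) Pword O u = 1.
  rewrite !big_cons big_nil addr0 !Pword_cons Pword_nil !mulr1.
  exact: gen_sum2.
have H' : \sum_(u <- [:: [:: ord0]; [:: ord_max] : word]) Pword O u = 1.
  by rewrite -[RHS]H !big_cons !big_nil !addr0 addrC.
split => //.
- rewrite !big_cons big_nil addr0 /=.
  have := @sum_Pword_cons ord0 ord_max _ isT H'.
  by rewrite !big_cons big_nil addr0 addrC addrA.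
- rewrite !big_cons big_nil addr0 /=.
  have := @sum_Pword_cons ord_max ord0 _ isT H'.
  by rewrite !big_cons big_nil addr0.
- by move=> x y; rewrite !inE => /or3P[]/eqP-> /or3P[]/eqP->.
Qed.

(* An element of F supported in the cylinder of w that has an odd slope there. *)
Lemma exists_local_tree_seq w : exists s x,
  [/\ tree_seq O s, x \in s, prefix w x.1 && prefix w x.2, ~~ even_pair x &
      forall y, y \in s -> y.1 = y.2 \/ prefix w y.1 /\ prefix w y.2].
Proof.
elim: w => [|i w [s [x [ts xs /andP[px1 px2] ox sw]]]].
  exists x0_pairs, ([:: ord0; ord0], [:: ord0]).
  split=> //; first exact: tree_seq_x0_pairs.
  by move=> y _; right; rewrite !prefix0s.
have [j ji] := exists_neq_letter i.
exists (graft i j s), (i :: x.1, i :: x.2); split.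
- by apply: tree_seq_graft => //; rewrite eq_sym.
- by rewrite inE (map_f (fun x => (i :: x.1, i :: x.2))) ?orbT.
- by rewrite /= eqxx px1.
- by move: ox; rewrite !even_pairE /= ; case: (odd _) (odd _) => [] [].
- move=> y; rewrite inE => /predU1P[->|/mapP[z zs ->]]; first by left.
  by case: (sw z zs) => [->|[z1 z2]]; [left|right; rewrite /= eqxx].
Qed.

Lemma incompar_prefix w u y : ~~ compar u w -> prefix w y -> ~~ compar y u.
Proof.
move=> uw /prefixP[d ->]; rewrite comparC.
by rewrite -[u]cats0 incompar_cat.
Qed.

(** Pairs below [w] kill [S u]. The remaining ones are diagonal, hence even, and their projections
    act on [S u] as the full sum 1 does. *)
Lemma local_sumS s w u : tree_seq O s ->
  (forall y, y \in s -> y.1 = y.2 \/ prefix w y.1 /\ prefix w y.2) ->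
  ~~ compar u w ->
  (\sum_(y <- s | even_pair y) pw y) * S u = S u /\
  (\sum_(y <- s | ~~ even_pair y) pw y) * S u = 0.
Proof.
move=> [_ _ s2 _] sw uw.
have ev (y : word * word) : y.1 = y.2 -> even_pair y.
  by move=> yE; rewrite even_pairE yE.
split.
  rewrite -[RHS]mul1r -s2 !mulr_suml big_mkcond.
  apply: eq_big_seq => y /sw[yE|[_ yw]].
    by rewrite ev // yE.
  rewrite -!mulrA star_Sword_incompar ?(incompar_prefix uw) // !mulr0.
  by case: ifP.
rewrite mulr_suml big_seq_cond big1 // => y /andP[/sw[yE|[_ yw]]].
  by rewrite ev.
by rewrite -mulrA star_Sword_incompar ?(incompar_prefix uw) // mulr0.
Qed.

Lemma local_star_sumS s w u : tree_seq O s ->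
  (forall y, y \in s -> y.1 = y.2 \/ prefix w y.1 /\ prefix w y.2) ->
  ~~ compar u w ->
  star (\sum_(y <- s | even_pair y) pw y) * S u = S u /\
  star (\sum_(y <- s | ~~ even_pair y) pw y) * S u = 0.
Proof.
move=> ts sw uw; have sw' y : y \in map pair_swap s ->
    y.1 = y.2 \/ prefix w y.1 /\ prefix w y.2.
  by move=> /mapP[[z1 z2] /sw /= zP ->] /=; case: zP => [->|[? ?]]; [left|right].
have [e o] := local_sumS (tree_seq_swap ts) sw' uw.
have swE y : even_pair (pair_swap y) = even_pair y.
  by rewrite !even_pairE eq_sym.
move: e o; rewrite !big_map => e o.
split; [rewrite -[RHS]e|rewrite -[RHS]o]; congr (_ * _); rewrite star_sum;
  by apply: eq_big => y; rewrite ?swE // starM starK.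
Qed.

(** Take k in F supported in [w] with an odd pair [x] there. The value of k.p on [x.1] is opposite
    to that of p on [x.2], which lies below [w]; off [w], k acts trivially. *)
Lemma flip_on_cylinder p w b : cylinder_value (val p) w b ->
  exists p' d, cylinder_value (val p') (w ++ d) (~~ b) /\
    forall u c, ~~ compar u w -> cylinder_value (val p) u c ->
      cylinder_value (val p') u c.
Proof.
move=> wb; have [s [x [ts xs /andP[/prefixP[d1 x1] /prefixP[d2 x2]] ox sw]]] :=
  exists_local_tree_seq w.
have tk := tree_seq_pair ts.
have ks : thompson_set (pair_sum O [fset x in s]%fset) by exists [fset x in s]%fset.
pose k : thompson O := exist (fun y => y \in @thompson_set R O) _ (mem_set ks).
have ke : even_part k = \sum_(y <- s | even_pair y) pw y.
  by rewrite (@even_partE _ _ k _ tk) // /pair_sum_even big_fset_seq //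
    (tree_seq_uniq ts).
have ko : odd_part k = \sum_(y <- s | ~~ even_pair y) pw y.
  by rewrite (@odd_partE _ _ k _ tk) // /pair_sum_odd big_fset_seq //
    (tree_seq_uniq ts).
exists (act k p), d1; split=> [|u c uw pu].
  rewrite /cylinder_value /= /Omega_act ke ko mulrDl -!mulrA -x1 -[x.1]cats0.
  rewrite !tree_seq_star_sumS // (negbTE ox) mulr0n !mulr0 add0r mulr1n cats0.
  rewrite mulrBl mul1r x2 (cylinder_value_cat d2 wb) mulrBr mulrnAr -x2.
  rewrite -[x.2]cats0 tree_seq_sumS // ox cats0.
  by case: b {wb}; rewrite ?subrr ?subr0.
rewrite /cylinder_value /= /Omega_act ke ko mulrDl -!mulrA.
have [-> ->] := local_star_sumS ts sw uw; have [kS _] := local_sumS ts sw uw.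
by rewrite !mulr0 addr0 pu mulrnAr kS.
Qed.

(** * A point moved by finitely many nontrivial elements *)

Lemma thompson_neq1 g : g != 1%g ->
  exists2 x, x \in presentation g & x.2 != x.1.
Proof.
have [/tree_pair_seq tg gE] := presentationP g.
move=> g1; apply: contrapT => nx; move/negP: g1; apply; apply/eqP/val_inj.
rewrite gE /=; case: (tg) => _ <- _ _; apply: eq_big_seq => x xg.
rewrite /Pword; congr (_ * star (S _)); apply: contrapT => /eqP xE.
by apply: nx; exists x.
Qed.

Lemma exists_moved (gs : seq (thompson O)) : all (fun g => g != 1%g) gs ->
  exists p, forall g, g \in gs -> exists u v, moves_at g (val p) u v.
Proof.
elim: gs => [_|g gs IH /= /andP[/thompson_neq1[x xg x21] /IH[p pgs]]].
  have O1 : Omega_set (even_part (1%g : thompson O) * star (even_part 1%g)).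
    by exists 1%g.
  by exists (exist (fun y => y \in @Omega_set R O) _ (mem_set O1)).
(* [c0] separates source from target, [d] avoids the earlier witnesses, and [c1], [c2] make p
   constant on target and source. *)
have [c0 c0P] := exists_incompar_catr x21.
have [d dP] := moves_at_avoid (x.2 ++ c0) pgs.
have [c1 [b1 pv]] := Omega_cylinder_value p (x.1 ++ c0 ++ d).
have [c2 [b2 pu]] := Omega_cylinder_value p (x.2 ++ c0 ++ d ++ c1).
pose c := c0 ++ d ++ c1 ++ c2.
have {}pv : cylinder_value (val p) (x.1 ++ c) b1.
  by have := cylinder_value_cat c2 pv; rewrite /c !catA.
have {}pu : cylinder_value (val p) (x.2 ++ c) b2.
  by move: pu; rewrite /c !catA.
(* Either p is already moved by g, or flipping p on the source alone makes it so. *)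
have [b12|b12] := eqVneq b1 (b2 (+) even_pair x).
  exists p => h; rewrite inE => /predU1P[->|/pgs //].
  by exists (x.2 ++ c), (x.1 ++ c), x, c, b2; rewrite -b12.
have [p' [e [p'u p'E]]] := flip_on_cylinder pu.
exists p' => h; rewrite inE => /predU1P[->|/dP[u [v [uv ud vd]]]].
  exists (x.2 ++ c ++ e), (x.1 ++ c ++ e), x, (c ++ e), (~~ b2); split => //.
    by rewrite catA.
  rewrite catA; apply: cylinder_value_cat.
  have -> : ~~ b2 (+) even_pair x = b1.
    by move: b12; case: b1 b2 (even_pair x) {pv pu p'u} => [] [] [].
  apply: p'E => //.
  by rewrite comparC /c !(catA _ c0) incompar_cat.
have awd y : ~~ compar y ((x.2 ++ c0) ++ d) -> ~~ compar y (x.2 ++ c).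
  by rewrite -{2}[y]cats0 /c !catA -(catA _ c1); exact: incompar_cat.
case: uv => y [a [b' [yh uE vE yu yv]]].
by exists u, v, y, a, b'; split => //; apply: p'E => //; exact: awd.
Qed.

(** * Recovering coefficients from matrix entries *)

Lemma bounded_op_sumE (T : choiceType) (I : Type) (r : seq I)
    (B : I -> bounded_op R T) (z : l2 R T) t :
  (\sum_(i <- r) B i) z t = \sum_(i <- r) B i z t.
Proof. by elim/big_rec2: _ => // i _ y _ <-. Qed.

Lemma pi2_ext_delta (a : group_algebra O) p q :
  pi2_ext a (l2_delta R p) q = \sum_(g <- finsupp a) a g * (q == act g p)%:R.
Proof.
rewrite bounded_op_sumE; apply: eq_bigr => g _.
have -> : (a g *: pi2 g) (l2_delta R p) q = a g * pi2 g (l2_delta R p) q by [].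
by rewrite pi2_delta.
Qed.

End faithful.

Theorem proposition2p1 (R : realType) (O : cuntzAlgType R) :
  injective (@pi2_ext R O).
Proof.
move=> a b ab; apply/fsfunP => f.
(* f.p = g.p exactly when f^-1 g fixes p. Both supports enter, so that one p serves for [a] and
   [b]. *)
pose r := [seq (f^-1 * g)%g | g <- enum_fset (finsupp a) ++ enum_fset (finsupp b)].
have [|p pP] := @exists_moved R O [seq g <- r | g != 1%g].
  exact: filter_all.
have coef c : {subset finsupp c <= enum_fset (finsupp a) ++ enum_fset (finsupp b)} ->
    pi2_ext c (l2_delta R p) (act f p) = c f.
  move=> cr; rewrite pi2_ext_delta.
  transitivity (\sum_(g <- finsupp c | g == f) c g).
    rewrite [RHS]big_mkcond; apply: eq_big_seq => g gc.
    have [->|gf] := eqVneq g f; first by rewrite eqxx mulr1.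
    suff /eqP/negbTE -> : act f p <> act g p by rewrite mulr0.
    move=> fg; have fgr : (f^-1 * g)%g \in [seq g <- r | g != 1%g].
      rewrite mem_filter map_f ?cr // andbT.
      apply: contraNN gf => /eqP/(congr1 (fun h => (f * h)%g)).
      by rewrite mulVKg mulg1 => ->.
    have [u [v /moves_at_act]] := pP _ fgr; apply.
    by rewrite actM -fg -actM mulVg act1.
  have [fc|fc] := boolP (f \in finsupp c).
    by rewrite -big_filter filter_pred1_uniq ?fset_uniq // big_seq1.
  rewrite (fsfun_dflt fc) big_seq_cond big1 // => g /andP[gc /eqP gf].
  by rewrite -gf gc in fc.
rewrite -(coef a) -?(coef b) ?ab // => g gc; by rewrite mem_cat gc ?orbT.
Qed.
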